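(* Let $G^S$ be a cycle on $n\ge 3$ state nodes, and let the network $\mathcal G=G^S\cup G^I$ have exactly two external input nodes $u_1,u_2$, attached to distinct state nodes $v_1,v_2$. Then $\mathcal G$ is strongly structurally controllable if and only if $v_1$ and $v_2$ are adjacent in $G^S$.
   Context: Network model: a network $\mathcal G=G^S\cup G^I$ consists of an undirected simple state graph $G^S$ on state nodes $\{1,\dots,n\}$ and a set of $m$ external input nodes $u_1,\dots,u_m$, where each input node $u_r$ has exactly one directed edge, to a state node $v_r$, and the $v_r$ are pairwise distinct; the input matrix is $B=[e_{v_1},\dots,e_{v_m}]\in\mathbb R^{n\times m}$. The dynamics are $\dot x=Mx+Bu$, where $M$ ranges over the family $Q(G^S)$ of symmetric matrices with $M_{ij}=a_{ij}>0$ if $\{i,j\}$ is an edge of $G^S$, $M_{ij}=0$ if $i\ne j$ are non-adjacent, and $M_{ii}=-\sum_{j\in\mathcal N_i}a_{ij}+a_{ii}$ with an arbitrary self-loop weight $a_{ii}<0$ ($\mathcal N_i$ the neighbours of $i$ in $G^S$). The network is strongly structurally controllable (SSC) if for every $M\in Q(G^S)$ the controllability matrix $[B,MB,\dots,M^{n-1}B]$ has rank $n$. *)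

(* Defs.v *)
From HB Require Import structures.
From mathcomp Require Import all_boot all_order all_algebra.
From mathcomp Require Import reals.
Set Implicit Arguments. Unset Strict Implicit. Unset Printing Implicit Defensive.
Import Order.TTheory GRing.Theory Num.Theory.
Local Open Scope ring_scope.

Definition cycle_adj (n : nat) (i j : 'I_n) : bool :=
  (val j == (val i).+1 %% n)%N || (val i == (val j).+1 %% n)%N.

Definition in_Q (R : realType) (n : nat) (adj : rel 'I_n) (M : 'M[R]_n) : Prop :=
  [/\ M^T = M,
      (forall i j : 'I_n, i != j -> adj i j -> 0 < M i j),
      (forall i j : 'I_n, i != j -> ~~ adj i j -> M i j = 0) &
      (forall i : 'I_n, exists aii : R,
          aii < 0 /\ M i i = - (\sum_(j < n | adj i j) M i j) + aii)].

Definition input_mx (R : realType) (n m : nat) (v : 'I_m -> 'I_n) : 'M[R]_(n, m) :=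
  \matrix_(i < n, r < m) (i == v r)%:R.

Fixpoint krylov (R : realType) (n m : nat) (M : 'M[R]_n) (B : 'M[R]_(n, m)) (k : nat)
  : 'M[R]_(n, k * m) :=
  match k return 'M[R]_(n, k * m) with
  | 0 => 0
  | k'.+1 => row_mx B (M *m krylov M B k')
  end.

Definition ctrb_mx (R : realType) (n m : nat) (M : 'M[R]_n) (B : 'M[R]_(n, m)) :=
  krylov M B n.

(* Strong structural controllability of the network with state graph adj and
   inputs attached to v_1, ..., v_m (v injective). *)
Definition SSC (R : realType) (n m : nat) (adj : rel 'I_n) (v : 'I_m -> 'I_n) : Prop :=
  forall M : 'M[R]_n, in_Q adj M -> \rank (ctrb_mx M (input_mx R v)) = n.

Definition two_inputs (n : nat) (v1 v2 : 'I_n) : 'I_2 -> 'I_n :=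
  fun r => if val r == 0%N then v1 else v2.

(* Main.v *)
(** A row vector annihilates the controllability matrix iff every vector
    [x M^k], [k < n], vanishes at the input nodes.  If the inputs sit at
    consecutive nodes, the tridiagonal recurrence spreads the zeros around the
    cycle one node at a time, so [x = 0].  If they are not adjacent, they cut
    the cycle into two nonempty arcs; the vector equal to [1] on one arc, [-1] on
    the other and [0] at the inputs is an eigenvector of a matrix of the family
    with unit edge weights and suitable self-loops. *)
Require Import Defs.
From HB Require Import structures.
From mathcomp Require Import all_boot all_order all_algebra.
From mathcomp Require Import reals zify lra.
Set Implicit Arguments. Unset Strict Implicit. Unset Printing Implicit Defensive.
Import Order.TTheory GRing.Theory Num.Theory.
Local Open Scope ring_scope.

Lemma rank_eq_rows (F : fieldType) (n p : nat) (A : 'M[F]_(n, p)) :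
  \rank A = n <-> forall x : 'rV_n, x *m A = 0 -> x = 0.
Proof.
split=> [rkA x xA0 | inj].
  have fA : row_free A by rewrite /row_free rkA.
  by apply: (row_free_inj fA); rewrite xA0 mul0mx.
apply/eqP; rewrite -[_ == _]/(row_free A) -kermx_eq0.
by apply/rowV0P => x /sub_kermxP; apply: inj.
Qed.

Lemma mul_krylovS_eq0 (R : realType) (n m : nat) (M : 'M[R]_n) (B : 'M_(n, m))
    (k : nat) (x : 'rV_n) :
  x *m krylov M B k.+1 = 0 <-> x *m B = 0 /\ x *m M *m krylov M B k = 0.
Proof.
rewrite /= mul_mx_row mulmxA; split=> [xK0 | [-> ->]]; last exact: row_mx0.
by apply: eq_row_mx; rewrite xK0 row_mx0.
Qed.

(** The easy half of the Popov-Belevitch-Hautus test, for left eigenvectors; it yields the failure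
    of controllability for non-adjacent inputs. *)
Lemma eigenvector_krylov_eq0 (R : realType) (n m : nat) (M : 'M[R]_n)
    (B : 'M_(n, m)) (a : R) (x : 'rV_n) (k : nat) :
  x *m M = a *: x -> x *m B = 0 -> x *m krylov M B k = 0.
Proof.
move=> xM xB; elim: k => [|k IHk]; first exact: mulmx0.
by apply/mul_krylovS_eq0; rewrite xM -scalemxAl IHk scaler0.
Qed.

Lemma mul_input_mxE (R : realType) (n m : nat) (v : 'I_m -> 'I_n) (x : 'rV[R]_n) r :
  (x *m input_mx R v) 0 r = x 0 (v r).
Proof.
rewrite mxE (bigD1 (v r)) //= mxE eqxx mulr1 big1 ?addr0 // => i /negPf ne.
by rewrite mxE ne mulr0.
Qed.

Lemma mul_two_inputs_eq0 (R : realType) (n : nat) (v1 v2 : 'I_n) (x : 'rV[R]_n) :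
  x *m input_mx R (two_inputs v1 v2) = 0 <-> x 0 v1 = 0 /\ x 0 v2 = 0.
Proof.
split=> [/rowP xB | [x1 x2]].
  by split; [have := xB 0 | have := xB 1]; rewrite mul_input_mxE mxE.
apply/rowP => r; rewrite mul_input_mxE mxE /two_inputs.
by case: ifP.
Qed.

Lemma cycle_adjE (n : nat) (i j : 'I_n) :
  cycle_adj i j = (j == ordS i) || (j == ord_pred i).
Proof.
by rewrite -(can2_eq (@ordSK n) (@ord_predK n)) [ordS j == i]eq_sym.
Qed.

Lemma cycle_adj_sym (n : nat) (i j : 'I_n) : cycle_adj i j = cycle_adj j i.
Proof. exact: orbC. Qed.

Lemma val_ordS (n : nat) (i : 'I_n) :
  ordS i = (if i.+1 == n then 0 else i.+1)%N :> nat.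
Proof.
have := ltn_ord i; rewrite /=; case: eqP => [-> _ | ne lt].
  by rewrite modnn.
by rewrite modn_small // ltn_neqAle lt andbT; apply/eqP.
Qed.

Lemma val_ord_pred (n : nat) (i : 'I_n) :
  ord_pred i = (if i == 0 :> nat then n.-1 else i.-1)%N :> nat.
Proof.
have ltin := ltn_ord i; rewrite /=; case: eqP => [-> | ne].
  by rewrite add0n modn_small //; lia.
have -> : (i + n).-1 = (i.-1 + n)%N by lia.
by rewrite modnDr modn_small //; lia.
Qed.

Lemma sum_cycle_adj (R : realType) (n : nat) (F : 'I_n -> R) (i : 'I_n) :
  (3 <= n)%N ->
  \sum_(j < n | cycle_adj i j) F j = F (ordS i) + F (ord_pred i).
Proof.
move=> n3.
(* From [n = 3] on the two neighbours differ, so neither term is counted twice. *)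
have ne : ord_pred i != ordS i.
  apply/eqP => /(congr1 (@nat_of_ord n)); rewrite val_ord_pred val_ordS.
  by have := ltn_ord i; do 2![case: eqP => ?]; lia.
rewrite (bigD1 (ordS i)) /= ?cycle_adjE ?eqxx //; congr (_ + _).
rewrite (bigD1 (ord_pred i)) /= ?cycle_adjE ?eqxx ?orbT ?ne //.
rewrite big1 ?addr0 // => j; rewrite cycle_adjE.
by case: (j == _); case: (j == _).
Qed.

Lemma cycle_adj_irrefl (n : nat) (i : 'I_n) : (3 <= n)%N -> ~~ cycle_adj i i.
Proof.
move=> n3; rewrite /cycle_adj orbb; change (val i != ordS i).
by apply/eqP; rewrite val_ordS /=; have := ltn_ord i; case: eqP => ?; lia.
Qed.

Lemma mul_in_Q_cycle (R : realType) (n : nat) (M : 'M[R]_n) (x : 'rV_n) (i : 'I_n) :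
  (3 <= n)%N -> in_Q (@cycle_adj n) M ->
  (x *m M) 0 i =
    x 0 i * M i i + (x 0 (ordS i) * M (ordS i) i
                     + x 0 (ord_pred i) * M (ord_pred i) i).
Proof.
move=> n3 [_ _ M0 _]; rewrite mxE.
rewrite (bigID (fun j => cycle_adj i j)) /= sum_cycle_adj // addrC; congr (_ + _).
rewrite (bigD1 i) ?cycle_adj_irrefl //= big1 ?addr0 // => j /andP[nadj ne].
by rewrite M0 ?mulr0 // cycle_adj_sym.
Qed.

Lemma val_iter_ordS (n : nat) (k : nat) (i : 'I_n) :
  iter k (@ordS n) i = ((i + k) %% n)%N :> nat.
Proof.
elim: k => [|k IHk]; first by rewrite addn0 modn_small.
by rewrite iterS /= IHk -addn1 modnDml addn1 addnS.
Qed.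

Lemma iter_ordS_surj (n : nat) (i j : 'I_n) :
  exists2 k, (k < n)%N & j = iter k (@ordS n) i.
Proof.
have ni := ltn_ord i; have nj := ltn_ord j.
(* The distance from [i] to [j] along the cycle; adding [n - i] avoids truncated subtraction when
   [j < i]. *)
exists ((j + (n - i)) %% n)%N; first by rewrite ltn_mod; lia.
apply/val_inj; rewrite /= val_iter_ordS modnDmr.
have -> : (i + (j + (n - i)) = j + n)%N by lia.
by rewrite modnDr modn_small.
Qed.

(* Reading [x M] at the last known zero expresses the next entry of [x], at the
   cost of one Krylov step. *)
Lemma krylov_zero_propagation (R : realType) (n : nat) (M : 'M[R]_n) (v : 'I_n)
    (j k : nat) (x : 'rV_n) :
  (3 <= n)%N -> in_Q (@cycle_adj n) M -> (j < k)%N ->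
  x *m krylov M (input_mx R (two_inputs v (ordS v))) k = 0 ->
  x 0 (iter j (@ordS n) v) = 0 /\ x 0 (iter j.+1 (@ordS n) v) = 0.
Proof.
move=> n3 QM; elim: j k x => [|j IHj] [|k] x // ltjk xK.
  by have /mul_krylovS_eq0[/mul_two_inputs_eq0] := xK.
have [x0 x1] := IHj _ _ (ltnW ltjk) xK; split=> //.
(* Second use of the induction hypothesis, now for [x *m M] and one Krylov block fewer; hence the
   induction over all [k] and [x]. *)
have /mul_krylovS_eq0[_ /(IHj _ _ ltjk)[_]] := xK.
rewrite mul_in_Q_cycle // x1 mul0r add0r iterS ordSK x0 mul0r addr0 -!iterS.
set i := iter j.+1 _ v => /eqP; rewrite mulf_eq0 => /orP[/eqP // | /eqP M0].
have adj : cycle_adj (ordS i) i by rewrite cycle_adj_sym cycle_adjE eqxx.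
have ne : ordS i != i.
  by apply: contraL adj => /eqP ->; exact: cycle_adj_irrefl.
by case: QM => _ /(_ _ _ ne adj) + _ _; rewrite -[iter j.+2 _ v]/(ordS i) M0 ltxx.
Qed.

Lemma SSC_consecutive (R : realType) (n : nat) (v : 'I_n) :
  (3 <= n)%N -> SSC R (@cycle_adj n) (two_inputs v (ordS v)).
Proof.
move=> n3 M QM; apply/rank_eq_rows => x xK; apply/rowP => i; rewrite mxE.
(* Every node lies fewer than [n] steps after [v], and there are [n] Krylov blocks to spend. *)
have [j ltjn ->] := iter_ordS_surj v i.
by have [] := krylov_zero_propagation n3 QM ltjn xK.
Qed.

(** Swapping the inputs permutes columns within each block; comparing left annihilators avoids
    writing the permutation. *)
Lemma SSC_two_inputsC (R : realType) (n : nat) (adj : rel 'I_n) (v1 v2 : 'I_n) :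
  SSC R adj (two_inputs v1 v2) -> SSC R adj (two_inputs v2 v1).
Proof.
move=> ssc M QM; apply/rank_eq_rows => x xK.
have /rank_eq_rows := ssc M QM; apply; rewrite /ctrb_mx.
suff swap k : x *m krylov M (input_mx R (two_inputs v2 v1)) k = 0 ->
    x *m krylov M (input_mx R (two_inputs v1 v2)) k = 0 by exact: swap.
elim: k x {xK} => [|k IHk] x; first by rewrite !mulmx0.
move=> /mul_krylovS_eq0[/mul_two_inputs_eq0[x2 x1] /IHk xK].
by apply/mul_krylovS_eq0; split=> //; apply/mul_two_inputs_eq0.
Qed.

(** The future eigenvector. For [v1 < v2], the value [-1] marks the arc from [v2] to [v1] that wraps
    around the numbering. *)
Definition arc_sign (R : realType) (n : nat) (v1 v2 i : 'I_n) : R :=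
  if (i == v1) || (i == v2) then 0 else if (v1 < i < v2)%N then 1 else -1.

(** No edge joins the two arcs directly: every passage goes through an input, where the sign is
    0. *)
Lemma arc_sign_edge (R : realType) (n : nat) (v1 v2 i : 'I_n) :
  (v1 < v2)%N -> 0 <= arc_sign R v1 v2 i * arc_sign R v1 v2 (ordS i).
Proof.
move=> lt12; rewrite /arc_sign.
have := ltn_ord i; have := ltn_ord v2; have := val_ordS i.
move: (ordS i) => j; rewrite -!val_eqE /=.
case: (i.+1 =P n) => ? -> ? ?; do ![case: ifP => ?];
  by rewrite ?mulr0 ?mul0r ?mulrNN ?mulr1 ?ler01 //; lia.
Qed.

(** Zeros occur only at inputs. By non-adjacency the two neighbours of an input are not inputs, and
    they lie on opposite arcs. *)
Lemma arc_sign_balance (R : realType) (n : nat) (v1 v2 i : 'I_n) :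
  (v1 < v2)%N -> ~~ cycle_adj v1 v2 -> arc_sign R v1 v2 i = 0 ->
  arc_sign R v1 v2 (ordS i) + arc_sign R v1 v2 (ord_pred i) = 0.
Proof.
move=> lt12 nadj si0.
have {}si0 : (i == v1) || (i == v2).
  move: si0; rewrite /arc_sign; case: (_ || _) => //.
  by case: ifP => _ /eqP; rewrite ?oppr_eq0 oner_eq0.
have lt2 := ltn_ord v2.
case/orP: si0 => /eqP->; [|rewrite cycle_adj_sym in nadj]; move: nadj;
  rewrite cycle_adjE /arc_sign; [set i1 := v1|set i1 := v2];
  have := val_ord_pred i1; have := val_ordS i1;
  move: (ordS i1) (ord_pred i1) => j k; rewrite {}/i1 -!val_eqE /=;
  case: (_.+1 =P n) => ? ->; case: (_ =P 0%N :> nat) => ? -> ?;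
  by do ![case: ifP => ?]; rewrite ?subrr ?addNr ?addr0 //; lia.
Qed.

Lemma not_SSC_arcs (R : realType) (n : nat) (v1 v2 : 'I_n) :
  (3 <= n)%N -> (v1 < v2)%N -> ~~ cycle_adj v1 v2 ->
  ~ SSC R (@cycle_adj n) (two_inputs v1 v2).
Proof.
move=> n3 lt12 nadj ssc.
pose s := arc_sign R v1 v2.
pose S i := s (ordS i) + s (ord_pred i).
(* The diagonal solves [M i i * s i + S i = -3 * s i] where [s i] is 1 or -1. The two unit edges
   account for -2 of the -3, leaving the self-loop [-1 - s i * S i], negative once [s i * S i] is
   nonnegative. *)
pose M : 'M[R]_n := \matrix_(i, j)
  if i == j then - 3 - s i * S i else (cycle_adj i j)%:R.
have sS_ge0 i : 0 <= s i * S i.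
  rewrite mulrDr addr_ge0 ?arc_sign_edge // mulrC -[in s i](ord_predK i).
  exact: arc_sign_edge.
have adjS (i : 'I_n) : cycle_adj i (ordS i) by rewrite cycle_adjE eqxx.
have adjP (i : 'I_n) : cycle_adj i (ord_pred i) by rewrite cycle_adjE eqxx orbT.
have M1 i j : cycle_adj i j -> M i j = 1.
  move=> adj; rewrite mxE adj ifN //.
  by apply: contraL adj => /eqP ->; exact: cycle_adj_irrefl.
have QM : in_Q (@cycle_adj n) M.
  split=> [|i j _ /M1 -> // |i j /negPf ne /negPf nadj_ij|i].
  - apply/matrixP => i j; rewrite !mxE eq_sym cycle_adj_sym.
    by case: eqP => // ->.
  - by rewrite mxE ne nadj_ij.
  - exists (- 1 - s i * S i); split; first by have := sS_ge0 i; lra.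
    by rewrite sum_cycle_adj // (M1 _ _ (adjS i)) (M1 _ _ (adjP i)) mxE eqxx; lra.
pose x : 'rV[R]_n := \row_i s i.
have xM : x *m M = (- 3) *: x.
  apply/rowP => i; rewrite mul_in_Q_cycle //.
  have -> : M (ordS i) i = 1 by rewrite M1 // cycle_adj_sym.
  have -> : M (ord_pred i) i = 1 by rewrite M1 // cycle_adj_sym.
  rewrite !mxE eqxx !mulr1 -/(S i).
  (* At an input the neighbours cancel; elsewhere the diagonal term absorbs [S i]. *)
  have [s0 | s1] : s i = 0 \/ s i * s i = 1.
    by rewrite /s /arc_sign; do 2?[case: ifP => _]; rewrite ?mulrNN ?mulr1; auto.
    by have := arc_sign_balance lt12 nadj s0; rewrite -/(S i) s0 => ->; lra.
  by rewrite mulrBr mulrA s1; lra.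
have xB : x *m input_mx R (two_inputs v1 v2) = 0.
  by apply/mul_two_inputs_eq0; rewrite !mxE /s /arc_sign !eqxx orbT.
have /rank_eq_rows/(_ x (eigenvector_krylov_eq0 _ xM xB)) := ssc M QM.
(* The node after [v1] is not an input, so [x] is nonzero there. *)
have ne : (ordS v1 != v1) && (ordS v1 != v2).
  apply/andP; split; apply/eqP => e.
    by have := adjS v1; rewrite e; apply/negP/cycle_adj_irrefl.
  by move: nadj; rewrite -e adjS.
move=> /rowP/(_ (ordS v1)); rewrite !mxE /s /arc_sign.
have [/negPf -> /negPf ->] := andP ne.
by case: ifP => _ /eqP; rewrite ?oppr_eq0 oner_eq0.
Qed.

Theorem theorem3 (R : realType) (n : nat) (hn : (3 <= n)%N) (v1 v2 : 'I_n) :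
  v1 != v2 ->
  (SSC R (cycle_adj (n:=n)) (two_inputs v1 v2) <-> cycle_adj v1 v2).
Proof.
move=> ne12; split=> [ssc | ].
  apply/negPn/negP => nadj; move: ne12; rewrite -val_eqE neq_ltn /= => /orP[lt | lt].
    exact: not_SSC_arcs lt nadj ssc.
  rewrite cycle_adj_sym in nadj.
  exact: not_SSC_arcs lt nadj (SSC_two_inputsC ssc).
rewrite cycle_adjE => /orP[/eqP -> | /eqP ->]; first exact: SSC_consecutive.
apply: SSC_two_inputsC; rewrite -{2}(ord_predK v1); exact: SSC_consecutive.
Qed.
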